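(* Let $a$ be a complex number. Then: (i) if $\operatorname{Re} a<0$, $${}_3F_2\left(a,a+\tfrac13,a+\tfrac23;\tfrac13,\tfrac23;1\right)=2\cdot 3^{-3a/2-1}\cos\frac{\pi a}{2};$$ (ii) if $\operatorname{Re} a<1/3$, $${}_3F_2\left(a,a+\tfrac13,a+\tfrac23;\tfrac23,\tfrac43;1\right)=\frac{2}{1-3a}\,3^{-(3a+1)/2}\cos\left(\frac{(3a+1)\pi}{6}\right);$$ (iii) if $\operatorname{Re} a<2/3$ and $a\neq 1/3$, $${}_3F_2\left(a,a+\tfrac13,a+\tfrac23;\tfrac43,\tfrac53;1\right)=\frac{4}{(1-3a)(2-3a)}\,3^{-3a/2}\cos\left(\frac{(3a+2)\pi}{6}\right).$$
   Context: $(a)_n=\Gamma(a+n)/\Gamma(a)=a(a+1)\cdots(a+n-1)$ (with $(a)_0=1$) is the Pochhammer symbol. The generalized hypergeometric function at argument $1$ is the sum of the series ${}_3F_2(a,b,c;d,e;1)=\sum_{j=0}^\infty \frac{(a)_j(b)_j(c)_j}{(d)_j(e)_j\,j!}$, which converges when $\operatorname{Re}(d+e-a-b-c)>0$. For complex $s$, $3^{s}=e^{s\ln 3}$. *)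

(* Defs.v *)
From Stdlib Require Import Reals Factorial.
From Coquelicot Require Import Coquelicot.

Open Scope R_scope.
Open Scope C_scope.

Definition Cexp (z : C) : C :=
  RtoC (exp (Re z)) * (cos (Im z), sin (Im z)).

Definition Ccos (z : C) : C := (Cexp (Ci * z) + Cexp (- (Ci * z))) / 2.

(* x ^ s = exp (s ln x), meaningful for x > 0. *)
Definition Rpower_C (x : R) (s : C) : C := Cexp (s * RtoC (ln x)).

Fixpoint poch (a : C) (n : nat) : C :=
  match n with
  | O => 1
  | S m => poch a m * (a + RtoC (INR m))
  end.

Definition hyp3F2_term (a b c d e : C) (j : nat) : C :=
  (poch a j * poch b j * poch c j) /
  (poch d j * poch e j * RtoC (INR (fact j))).

(* 3F2(a, b, c; d, e; 1) = l: the series converges in C and its sum is l.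
   The parameters d, e must not be non-positive integers, since division by
   zero is total here. *)
Definition is_hyp3F2_at_1 (a b c d e l : C) : Prop :=
  is_series (hyp3F2_term a b c d e) l.

(* Main.v *)
Require Import Defs.
From Stdlib Require Import Reals Lra Lia Factorial.
From Coquelicot Require Import Coquelicot.

(* By the triplication formula for Pochhammer symbols, the three series are, up
   to a constant, the sums of (b)_n / n! over n = r mod 3, with b = 3a - r and
   r = 0, 1, 2; the hypotheses on a all say Re b < 0. Trisection with the cube
   roots of unity w reduces them to the binomial series of (1 - w)^(-b).

   At w = 1 the partial sums are (b+1)_N / N!, which tend to 0. At a primitive w
   the partial sum P_N(t) of the series of (1 - w t)^(-b) satisfies the exact
   equation
     (1 - w t) P_N' - b w P_N = - (N+1) c_{N+1} w^{N+1} t^N,  c_n = (b)_n / n!,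
   so integrating the derivative of (1 - w t)^b P_N(t) over [0, 1] shows that
   (1 - w)^b P_N(1) differs from 1 by O(|c_{N+1}|), which tends to 0. *)

Open Scope R_scope.
Open Scope C_scope.

(** * Pochhammer symbols and binomial coefficients *)

(** The coefficient of x^n in the expansion of (1 - x)^(-b). *)
Definition binc (b : C) (n : nat) : C := poch b n / INR (fact n).

Lemma sum_n_SC (u : nat -> C) (n : nat) :
  sum_n u (S n) = sum_n u n + u (S n).
Proof. exact (sum_Sn u n). Qed.

Lemma Cnat_S (n : nat) : RtoC (INR (S n)) = INR n + 1.
Proof. now rewrite S_INR, RtoC_plus. Qed.

Lemma Cnat_S_neq_0 (n : nat) : INR n + 1 <> 0.
Proof.
  rewrite <- Cnat_S. intros H. apply RtoC_inj in H.
  revert H. apply not_0_INR. lia.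
Qed.

Lemma Cfact_neq_0 (n : nat) : RtoC (INR (fact n)) <> 0.
Proof.
  intros H. apply RtoC_inj in H. exact (INR_fact_neq_0 n H).
Qed.

Lemma Cfact_S (n : nat) :
  RtoC (INR (fact (S n))) = (INR n + 1) * INR (fact n).
Proof. now rewrite <- Cnat_S, fact_simpl, mult_INR, RtoC_mult. Qed.

Lemma poch_S_l (b : C) (n : nat) : poch b (S n) = b * poch (b + 1) n.
Proof.
  induction n as [|n IH].
  - simpl. ring.
  - change (poch b (S (S n))) with (poch b (S n) * (b + INR (S n))).
    rewrite IH, Cnat_S. simpl. ring.
Qed.

Lemma poch_1 (n : nat) : poch 1 n = INR (fact n).
Proof.
  induction n as [|n IH]; [reflexivity|].
  rewrite Cfact_S, <- IH. simpl. ring.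
Qed.

(** The factors 3a + 3k, 3a + 3k + 1, 3a + 3k + 2 are 3 times a + k, a + 1/3 + k, a + 2/3 + k, so
    each block of three contributes 27. *)
Lemma poch_triplication (a : C) (n : nat) :
  poch (3 * a) (3 * n) =
  27 ^ n * (poch a n * poch (a + 1 / 3) n * poch (a + 2 / 3) n).
Proof.
  induction n as [|n IH]; [simpl; ring|].
  replace (3 * S n)%nat with (S (S (S (3 * n)))) by lia.
  change (poch (3 * a) (S (S (S (3 * n))))) with
    (poch (3 * a) (3 * n) * (3 * a + INR (3 * n))
      * (3 * a + INR (S (3 * n))) * (3 * a + INR (S (S (3 * n))))).
  rewrite IH, !Cnat_S, mult_INR, RtoC_mult.
  replace (RtoC (INR 3)) with (RtoC 3) by (f_equal; simpl; ring).
  rewrite Cpow_S. simpl poch. field.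
Qed.

Lemma binc_S (b : C) (n : nat) :
  (INR n + 1) * binc b (S n) = (b + INR n) * binc b n.
Proof.
  unfold binc. rewrite Cfact_S. simpl poch. field.
  split; [apply Cfact_neq_0 | apply Cnat_S_neq_0].
Qed.

Lemma binc_pred (b : C) (n : nat) :
  (INR n + 1) * binc b (S n) = b * binc (b + 1) n.
Proof.
  unfold binc. rewrite Cfact_S, poch_S_l. field.
  split; [apply Cfact_neq_0 | apply Cnat_S_neq_0].
Qed.

(** Summing coefficients amounts to multiplying (1 - x)^(-b) by 1 / (1 - x), which gives (1 -
    x)^(-(b + 1)). This puts the partial sums at w = 1 in closed form. *)
Lemma sum_binc (b : C) (N : nat) : binc (b + 1) N = sum_n (binc b) N.
Proof.
  induction N as [|N IH].
  - rewrite sum_O. reflexivity.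
  - rewrite sum_n_SC, <- IH.
    assert (H0 := Cnat_S_neq_0 N).
    assert (H1 := binc_pred b N). assert (H2 := binc_S (b + 1) N).
    replace (binc b (S N)) with (b * binc (b + 1) N / (INR N + 1))
      by (rewrite <- H1; field; exact H0).
    replace (binc (b + 1) (S N)) with
      ((b + 1 + INR N) * binc (b + 1) N / (INR N + 1))
      by (rewrite <- H2; field; exact H0).
    field. exact H0.
Qed.

(** * Decay of the binomial coefficients when Re b < 0 *)

(** With m = n + 1, |b + m|^2 = m^2 + 2 m Re b + |b|^2. For large m half of the negative cross term
    absorbs |b|^2, and the other half leaves room for d = - Re b / 2. *)
Lemma Cmod_nat_plus_le (b : C) : (Re b < 0)%R ->
  exists (d : R) (K : nat), (0 < d)%R /\
    forall n, (K <= n)%nat -> (Cmod (b + INR (S n)) <= INR (S n) - d)%R.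
Proof.
  intros Hb. destruct b as [x y]. simpl in Hb.
  (* The first summand makes m (- Re b) exceed |b|^2; the second keeps m - d positive, so that
     squares can be compared. *)
  destruct (INR_unbounded ((x * x + y * y) / - x + - x)) as [K HK].
  exists (- x / 2)%R, K. split; [lra|]. intros n Hn.
  assert (Hn' : (INR K <= INR n)%R) by now apply le_INR.
  rewrite S_INR.
  assert (Hq : (0 <= (x * x + y * y) / - x)%R).
  { apply Rdiv_le_0_compat; nra. }
  assert (Hk : (x * x + y * y <= (INR n + 1) * - x)%R).
  { replace (x * x + y * y)%R with ((x * x + y * y) / - x * - x)%R
      by (field; lra).
    apply Rmult_le_compat_r; lra. }
  unfold Cmod. rewrite <- (sqrt_pow2 (INR n + 1 - - x / 2)) by lra.
  apply sqrt_le_1_alt. simpl. nra.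
Qed.

Lemma ln_succ_le (n : nat) : (ln (INR n + 2) <= ln (INR n + 1) + / (INR n + 1))%R.
Proof.
  assert (Hn := pos_INR n).
  assert (Hi : (0 < / (INR n + 1))%R) by (apply Rinv_0_lt_compat; lra).
  replace (INR n + 2)%R with ((INR n + 1) * (1 + / (INR n + 1)))%R
    by (field; lra).
  rewrite ln_mult by lra. apply Rplus_le_compat_l.
  rewrite <- (ln_exp (/ (INR n + 1))) at 2.
  apply ln_le; [lra|]. apply exp_ineq1_le.
Qed.

(* The ratio of consecutive moduli is at most [1 - d / (n + 1)], so the moduli
   multiplied by [1 + d ln (n + 1)] eventually decrease. *)
Lemma is_lim_seq_binc_plus_1 (b : C) : (Re b < 0)%R ->
  is_lim_seq (fun n => Cmod (binc (b + 1) n)) 0.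
Proof.
  intros Hb. destruct (Cmod_nat_plus_le b Hb) as (d & K & Hd & HK).
  set (p := fun n => Cmod (binc (b + 1) n)).
  set (w := fun n => (1 + d * ln (INR n + 1))%R).
  assert (Hp : forall n, (0 <= p n)%R) by (intros n; apply Cmod_ge_0).
  assert (Hw : forall n, (1 <= w n)%R).
  { intros n. unfold w. assert (Hn := pos_INR n).
    assert (H : (0 <= ln (INR n + 1))%R)
      by (rewrite <- ln_1; apply ln_le; lra).
    nra. }
  assert (Hdec : forall n, (K <= n)%nat -> (p (S n) * w (S n) <= p n * w n)%R).
  { intros n Hn.
    assert (H := f_equal Cmod (binc_S (b + 1) n)).
    rewrite !Cmod_mult in H.
    replace (b + 1 + INR n) with (b + INR (S n)) in H
      by (rewrite Cnat_S; ring).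
    rewrite <- Cnat_S, Cmod_R, Rabs_pos_eq in H by apply pos_INR.
    assert (Hle := HK n Hn). assert (Hln := ln_succ_le n).
    fold (p (S n)) (p n) in H. assert (Hpn := Hp n). assert (Hwn := Hw n).
    assert (Hn0 := pos_INR n). rewrite S_INR in H, Hle.
    assert (HwS : (w (S n) <= w n + d / (INR n + 1))%R).
    { unfold w. rewrite S_INR.
      replace (INR n + 1 + 1)%R with (INR n + 2)%R by ring. nra. }
    assert (HpS : (p (S n) <= p n * (1 - d / (INR n + 1)))%R).
    { apply (Rmult_le_reg_l (INR n + 1)); [lra|].
      rewrite H. replace ((INR n + 1) * (p n * (1 - d / (INR n + 1))))%R
        with ((INR n + 1 - d) * p n)%R by (field; lra).
      now apply Rmult_le_compat_r. }
    assert (Hq : (0 < d / (INR n + 1))%R) by (apply Rdiv_lt_0_compat; lra).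
    set (q := (d / (INR n + 1))%R) in *.
    assert (HwS' := Hw (S n)). assert (HpS' := Hp (S n)).
    apply Rle_trans with (p (S n) * (w n + q))%R; [nra|].
    apply Rle_trans with (p n * (1 - q) * (w n + q))%R; [nra|].
    (* The difference of the two sides is q (w n - 1) + q^2, nonnegative because the weight is at
       least 1. *)
    assert ((1 - q) * (w n + q) <= w n)%R by nra. nra. }
  assert (Hbd : forall n, (p (n + K)%nat * w (n + K)%nat <= p K * w K)%R).
  { induction n as [|n IH]; [apply Rle_refl|].
    apply Rle_trans with (2 := IH). apply Hdec. lia. }
  (* From [K] on, [p] is at most a constant divided by [w], and [w] tends to infinity with the
     logarithm. *)
  apply (is_lim_seq_incr_n _ K).
  apply (is_lim_seq_le_le (fun _ => 0%R) _
           (fun n => (p K * w K * / w (n + K)%nat)%R)).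
  - intros n. split; [apply Hp|].
    assert (H := Hbd n). assert (H1 := Hw (n + K)%nat).
    change (Cmod (binc (b + 1) (n + K))) with (p (n + K)%nat).
    apply (Rmult_le_reg_r (w (n + K)%nat)); [lra|].
    rewrite Rmult_assoc, Rinv_l, Rmult_1_r by lra. exact H.
  - apply is_lim_seq_const.
  - replace (Finite 0) with (Rbar_mult (p K * w K)%R (Rbar_inv p_infty))
      by (simpl; f_equal; ring).
    apply is_lim_seq_scal_l.
    apply (is_lim_seq_incr_n (fun n => (/ w n)%R)).
    apply is_lim_seq_inv; [|discriminate].
    apply (is_lim_seq_plus _ _ 1 p_infty); [apply is_lim_seq_const| |reflexivity].
    replace p_infty with (Rbar_mult d p_infty).
    2:{ simpl. destruct Rle_dec; [|lra].
        destruct Rle_lt_or_eq_dec; [reflexivity|lra]. }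
    apply is_lim_seq_scal_l.
    apply (filterlim_comp _ _ _ (fun n => (INR n + 1)%R) ln _ (Rbar_locally p_infty)).
    2:{ exact is_lim_ln_p. }
    apply (is_lim_seq_ext (fun n => INR (S n))); [intros; apply S_INR|].
    apply (is_lim_seq_incr_1 INR). exact is_lim_seq_INR.
Qed.

(** By [binc_pred], |c_{n+1}| <= (n + 1) |c_{n+1}| = |b| |[binc (b + 1) n]|, which tends to 0. *)
Lemma is_lim_seq_binc (b : C) : (Re b < 0)%R ->
  is_lim_seq (fun n => Cmod (binc b (S n))) 0.
Proof.
  intros Hb.
  apply (is_lim_seq_le_le (fun _ => 0%R) _
           (fun n => (Cmod b * Cmod (binc (b + 1) n))%R)).
  - intros n. split; [apply Cmod_ge_0|].
    rewrite <- Cmod_mult, <- binc_pred, Cmod_mult, <- Cnat_S, Cmod_R.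
    assert (H := pos_INR n). assert (H' := Cmod_ge_0 (binc b (S n))).
    rewrite S_INR, Rabs_pos_eq by lra. nra.
  - apply is_lim_seq_const.
  - replace (Finite 0) with (Rbar_mult (Cmod b) 0) by (simpl; f_equal; ring).
    apply is_lim_seq_scal_l. now apply is_lim_seq_binc_plus_1.
Qed.

(** * Complex-valued functions of a real variable *)

(** Stated by components, so that the real differentiation rules and the real mean value theorem
    apply directly. *)
Definition is_Cderive (f : R -> C) (t : R) (l : C) : Prop :=
  is_derive (fun x => Re (f x)) t (Re l) /\
  is_derive (fun x => Im (f x)) t (Im l).

Lemma is_Cderive_ext (f g : R -> C) (t : R) (l : C) :
  (forall x, f x = g x) -> is_Cderive f t l -> is_Cderive g t l.
Proof.
  intros E [F1 F2]. split; (eapply is_derive_ext; [|eassumption]);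
  intros x; simpl; now rewrite E.
Qed.

Lemma is_Cderive_const (c : C) (t : R) : is_Cderive (fun _ => c) t 0.
Proof. split; apply @is_derive_const. Qed.

Lemma is_Cderive_plus (f g : R -> C) (t : R) (df dg : C) :
  is_Cderive f t df -> is_Cderive g t dg ->
  is_Cderive (fun x => f x + g x) t (df + dg).
Proof. intros [F1 F2] [G1 G2]. split; now apply @is_derive_plus. Qed.

Lemma is_Cderive_mult (f g : R -> C) (t : R) (df dg : C) :
  is_Cderive f t df -> is_Cderive g t dg ->
  is_Cderive (fun x => f x * g x) t (df * g t + f t * dg).
Proof.
  intros [F1 F2] [G1 G2].
  assert (M : forall (u v : R -> R) (du dv : R),
    is_derive u t du -> is_derive v t dv ->
    is_derive (fun x => (u x * v x)%R) t (du * v t + u t * dv)%R)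
    by (intros; apply is_derive_Reals, derivable_pt_lim_mult;
        now apply is_derive_Reals).
  split.
  - apply (is_derive_ext (fun x => Re (f x) * Re (g x) - Im (f x) * Im (g x))%R);
      [reflexivity|].
    replace (Re (df * g t + f t * dg)) with
      ((Re df * Re (g t) + Re (f t) * Re dg)
       - (Im df * Im (g t) + Im (f t) * Im dg))%R by (unfold Re, Im; simpl; ring).
    apply @is_derive_minus; now apply M.
  - apply (is_derive_ext (fun x => Re (f x) * Im (g x) + Im (f x) * Re (g x))%R);
      [reflexivity|].
    replace (Im (df * g t + f t * dg)) with
      ((Re df * Im (g t) + Re (f t) * Im dg)
       + (Im df * Re (g t) + Im (f t) * Re dg))%R by (unfold Re, Im; simpl; ring).
    apply @is_derive_plus; now apply M.
Qed.

Lemma is_Cderive_pow (n : nat) (t : R) :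
  is_Cderive (fun x => RtoC x ^ n) t (INR n * RtoC t ^ pred n).
Proof.
  split.
  - apply (is_derive_ext (fun x => x ^ n)%R);
      [intros x; now rewrite <- RtoC_pow|].
    rewrite <- RtoC_pow, <- RtoC_mult, re_RtoC.
    apply is_derive_Reals, derivable_pt_lim_pow.
  - apply (is_derive_ext (fun _ => 0%R));
      [intros x; now rewrite <- RtoC_pow|].
    rewrite <- RtoC_pow, <- RtoC_mult, im_RtoC. apply @is_derive_const.
Qed.

Lemma is_Cderive_exp (f : R -> C) (t : R) (df : C) :
  is_Cderive f t df ->
  is_Cderive (fun x => Cexp (f x)) t (Cexp (f t) * df).
Proof.
  intros [F1 F2].
  assert (D1 := is_derive_comp exp _ t _ _ (is_derive_exp _) F1).
  assert (D2 := is_derive_comp cos _ t _ _ (is_derive_cos _) F2).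
  assert (D3 := is_derive_comp sin _ t _ _ (is_derive_sin _) F2).
  assert (H := is_Cderive_mult (fun x => RtoC (exp (Re (f x))))
                 (fun x => (cos (Im (f x)), sin (Im (f x)))) t
                 (RtoC (Re df * exp (Re (f t)))%R)
                 ((Im df * - sin (Im (f t)))%R, (Im df * cos (Im (f t)))%R)).
  replace (Cexp (f t) * df) with
    (RtoC (Re df * exp (Re (f t)))%R * (cos (Im (f t)), sin (Im (f t)))
     + RtoC (exp (Re (f t)))
       * ((Im df * - sin (Im (f t)))%R, (Im df * cos (Im (f t)))%R)).
  - apply H; split; try assumption. exact (is_derive_const (0%R : R_NormedModule) t).
  - unfold Cexp. destruct df as [x y].
    apply injective_projections; simpl; ring.
Qed.

Lemma Cmod_Cexp (z : C) : Cmod (Cexp z) = exp (Re z).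
Proof.
  unfold Cexp. rewrite Cmod_mult, Cmod_R, Rabs_pos_eq by (left; apply exp_pos).
  unfold Cmod; simpl. rewrite !Rmult_1_r.
  assert (H := sin2_cos2 (Im z)). unfold Rsqr in H.
  rewrite Rplus_comm, H, sqrt_1. ring.
Qed.

Lemma Cexp_0 : Cexp 0 = 1.
Proof.
  unfold Cexp. simpl. rewrite exp_0, cos_0, sin_0.
  apply injective_projections; simpl; ring.
Qed.

Lemma Cexp_plus (z1 z2 : C) : Cexp (z1 + z2) = Cexp z1 * Cexp z2.
Proof.
  destruct z1, z2. unfold Cexp. simpl. rewrite exp_plus, cos_plus, sin_plus.
  apply injective_projections; simpl; ring.
Qed.

Lemma Cmod_le_Rabs (z : C) : (Cmod z <= Rabs (Re z) + Rabs (Im z))%R.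
Proof.
  replace z with (RtoC (Re z) + Ci * RtoC (Im z)) at 1
    by (destruct z; apply injective_projections; simpl; ring).
  eapply Rle_trans; [apply Cmod_triangle|].
  rewrite Cmod_mult, Cmod_Ci, !Cmod_R. lra.
Qed.

Lemma im_le_Cmod (z : C) : (Rabs (Im z) <= Cmod z)%R.
Proof.
  eapply Rle_trans; [apply Rmax_r|]. apply Rmax_Cmod.
Qed.

(** The bound on [df] is the derivative of K t^(n+1), which grows by exactly K on [0, 1]; the mean
    value theorem is applied to the difference. It replaces an integration. *)
Lemma increment_le_pow (f df : R -> R) (K : R) (n : nat) :
  (forall t, (0 <= t <= 1)%R -> is_derive f t (df t)) ->
  (forall t, (0 <= t <= 1)%R -> (df t <= K * (INR (S n) * t ^ n))%R) ->
  (f 1 - f 0 <= K)%R.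
Proof.
  intros Hf Hle.
  destruct (MVT_cor2 (fun t => f t - K * t ^ S n)%R
              (fun t => df t - K * (INR (S n) * t ^ n))%R 0 1 Rlt_0_1)
    as (c & Hc & Hc').
  - intros c Hc. apply (derivable_pt_lim_minus f (fun t => K * t ^ S n)%R).
    + apply is_derive_Reals. now apply Hf.
    + apply (derivable_pt_lim_scal (fun t => t ^ S n)%R).
      apply (derivable_pt_lim_pow c (S n)).
  - assert (H := Hle c ltac:(lra)).
    rewrite pow1, pow_i in Hc by lia. lra.
Qed.

(** The mean value theorem is real, so it is applied to plus and minus the real and imaginary parts
    separately; adding the two bounds costs the factor 2. *)
Lemma Cmod_increment_le_pow (f df : R -> C) (K : R) (n : nat) :
  (forall t, (0 <= t <= 1)%R -> is_Cderive f t (df t)) ->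
  (forall t, (0 <= t <= 1)%R -> (Cmod (df t) <= K * (INR (S n) * t ^ n))%R) ->
  (Cmod (f 1%R - f 0%R) <= 2 * K)%R.
Proof.
  intros Hf Hle.
  assert (Habs : forall g dg : R -> R,
    (forall t, (0 <= t <= 1)%R -> is_derive g t (dg t)) ->
    (forall t, (0 <= t <= 1)%R -> (Rabs (dg t) <= Cmod (df t))%R) ->
    (Rabs (g 1 - g 0) <= K)%R).
  { intros g dg Hg Hdg. apply Rabs_le. split.
    - enough (- g 1 - - g 0 <= K)%R by lra.
      apply (increment_le_pow (fun t => - g t)%R (fun t => - dg t)%R K n).
      + intros t Ht. apply @is_derive_opp. now apply Hg.
      + intros t Ht. assert (H1 := Hle t Ht). assert (H2 := Hdg t Ht).
        assert (H3 := Rle_abs (- dg t)). rewrite Rabs_Ropp in H3. lra.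
    - apply (increment_le_pow g dg K n Hg).
      intros t Ht. assert (H1 := Hle t Ht). assert (H2 := Hdg t Ht).
      assert (H3 := Rle_abs (dg t)). lra. }
  eapply Rle_trans; [apply Cmod_le_Rabs|].
  assert (H1 := Habs (fun t => Re (f t)) (fun t => Re (df t))
                  (fun t Ht => proj1 (Hf t Ht)) (fun t _ => re_le_Cmod _)).
  assert (H2 := Habs (fun t => Im (f t)) (fun t => Im (df t))
                  (fun t Ht => proj2 (Hf t Ht)) (fun t _ => im_le_Cmod _)).
  unfold Re, Im in *. simpl in *. unfold Rminus in *. lra.
Qed.

(** * The binomial series at the cube roots of unity *)

Definition binpoly (b w : C) (N : nat) (t : R) : C :=
  sum_n (fun n => binc b n * w ^ n * RtoC t ^ n) N.

(** At n = 0 the exponent [pred 0] is 0, and the factor [INR 0] makes the term vanish. *)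
Definition binpoly_derive (b w : C) (N : nat) (t : R) : C :=
  sum_n (fun n => binc b n * w ^ n * (INR n * RtoC t ^ pred n)) N.

Lemma is_Cderive_binpoly (b w : C) (N : nat) (t : R) :
  is_Cderive (binpoly b w N) t (binpoly_derive b w N t).
Proof.
  assert (T : forall n, is_Cderive (fun x => binc b n * w ^ n * RtoC x ^ n) t
                          (binc b n * w ^ n * (INR n * RtoC t ^ pred n))).
  { intros n.
    assert (H := is_Cderive_mult _ _ t _ _
                   (is_Cderive_const (binc b n * w ^ n) t) (is_Cderive_pow n t)).
    now rewrite Cmult_0_l, Cplus_0_l in H. }
  induction N as [|N IH].
  - unfold binpoly_derive. rewrite sum_O. refine (is_Cderive_ext _ _ _ _ _ (T 0%nat)).
    intros x. unfold binpoly. now rewrite sum_O.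
  - unfold binpoly_derive. rewrite sum_n_SC.
    refine (is_Cderive_ext _ _ _ _ _ (is_Cderive_plus _ _ t _ _ IH (T (S N)))).
    intros x. unfold binpoly. now rewrite sum_n_SC.
Qed.

(* The partial sums of [(1 - w t)^(-b)] satisfy its differential equation up to
   a single monomial. *)
Lemma binpoly_ode (b w : C) (N : nat) (t : R) :
  (1 - w * t) * binpoly_derive b w N t - b * w * binpoly b w N t
  = - (INR (S N) * binc b (S N) * w ^ S N * RtoC t ^ N).
Proof.
  induction N as [|N IH].
  - unfold binpoly, binpoly_derive. rewrite !sum_O.
    assert (H := binc_S b 0). rewrite Cnat_S. rewrite H.
    unfold binc. simpl. field.
  - unfold binpoly, binpoly_derive in *. rewrite !sum_n_SC.
    assert (D : forall x d d' y p p' : C,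
      x * (d + d') - y * (p + p') = (x * d - y * p) + (x * d' - y * p'))
      by (intros; ring).
    (* The term of degree N + 1 contributes (N + 1) c_{N+1} w^{N+1} t^N, cancelling the old
       remainder, and -(b + N + 1) c_{N+1} w^{N+2} t^{N+1}, which is the new one by [binc_S]. *)
    rewrite D, IH, (Cnat_S (S N)), binc_S. simpl pred. rewrite !Cpow_S. ring.
Qed.

(* [clog s t] is the principal logarithm of [1 - w t] for [w = -1/2 + i s] with
   [s^2 = 3/4], a primitive cube root of unity. *)
Definition clog (s t : R) : C :=
  ((ln (1 + t + t * t) / 2)%R, (- atan (s * t / (1 + t / 2)))%R).

Definition cubrt1 (s : R) : C := ((- / 2)%R, s).

(** This is -w / (1 - w t) with a real denominator: for s^2 = 3/4, |1 - w t|^2 = 1 + t + t^2. *)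
Definition clog_derive (s t : R) : C :=
  (((/ 2 + t) / (1 + t + t * t))%R, (- s / (1 + t + t * t))%R).

Lemma is_Cderive_clog (s t : R) : (s * s = 3 / 4)%R -> (0 <= t)%R ->
  is_Cderive (clog s) t (clog_derive s t).
Proof.
  intros Hs Ht. split; simpl.
  - auto_derive; [nra|]. field. nra.
  - auto_derive; [lra|].
    field_simplify_eq.
    + replace (s ^ 3)%R with (s * (s * s))%R by ring.
      replace (s ^ 2)%R with (s * s)%R by ring. rewrite Hs. field.
    + repeat split; try lra; nra.
Qed.

Lemma clog_derive_spec (s t : R) : (s * s = 3 / 4)%R -> (0 <= t)%R ->
  (1 - cubrt1 s * t) * clog_derive s t = - cubrt1 s.
Proof.
  intros Hs Ht. apply injective_projections; simpl.
  - field_simplify_eq; [|nra].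
    replace (s ^ 2)%R with (s * s)%R by ring. rewrite Hs. field.
  - field. nra.
Qed.

Lemma clog_0 (s : R) : clog s 0 = 0.
Proof.
  unfold clog. replace (1 + 0 + 0 * 0)%R with 1%R by ring.
  replace (s * 0 / (1 + 0 / 2))%R with 0%R by field.
  rewrite ln_1, atan_0. apply injective_projections; simpl; field.
Qed.

(** Gives a bound on |(1 - w t)^b| over [0, 1] that does not depend on N. The logarithm has real
    part in [0, ln 3 / 2] and imaginary part within PI / 2 of 0; the halves are dropped. *)
Lemma Re_mult_clog_le (b : C) (s t : R) : (0 <= t <= 1)%R ->
  (Re (b * clog s t) <= Rabs (Re b) * ln 3 + Rabs (Im b) * PI)%R.
Proof.
  intros Ht. rewrite re_mult. simpl.
  assert (H1 : (0 <= ln (1 + t + t * t))%R)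
    by (rewrite <- ln_1; apply ln_le; nra).
  assert (H2 : (ln (1 + t + t * t) <= ln 3)%R) by (apply ln_le; nra).
  assert (H3 := atan_bound (s * t / (1 + t / 2))).
  set (l := ln (1 + t + t * t)) in *. set (v := atan _) in *.
  assert (Hl : (Re b * (l / 2) <= Rabs (Re b) * ln 3)%R).
  { eapply Rle_trans; [apply Rle_abs|]. rewrite Rabs_mult.
    apply Rmult_le_compat_l; [apply Rabs_pos|]. apply Rabs_le. lra. }
  assert (Hv : (Im b * v <= Rabs (Im b) * PI)%R).
  { eapply Rle_trans; [apply Rle_abs|]. rewrite Rabs_mult.
    apply Rmult_le_compat_l; [apply Rabs_pos|]. apply Rabs_le. lra. }
  lra.
Qed.

Lemma Cmod_cubrt1 (s : R) : (s * s = 3 / 4)%R -> Cmod (cubrt1 s) = 1%R.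
Proof.
  intros Hs. unfold Cmod, cubrt1; simpl.
  replace (- / 2 * (- / 2 * 1) + s * (s * 1))%R with 1%R by lra.
  apply sqrt_1.
Qed.

(** The real part is already 1 + t / 2. This lets the factor 1 - w t be discarded when bounding a
    derivative. *)
Lemma Cmod_one_minus_cubrt1_ge (s t : R) : (0 <= t)%R ->
  (1 <= Cmod (1 - cubrt1 s * t))%R.
Proof.
  intros Ht. eapply Rle_trans; [|apply re_le_Cmod].
  rewrite Rabs_pos_eq; simpl; lra.
Qed.

(* With [E = (1 - w t)^b], [binpoly_ode] says that the derivative of [E * binpoly]
   has modulus at most [sup |E| * |binc b (N + 1)| * (N + 1) t^N]. *)
Lemma binpoly_error (b : C) (s : R) (N : nat) : (s * s = 3 / 4)%R ->
  (Cmod (Cexp (b * clog s 1) * binpoly b (cubrt1 s) N 1 - 1)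
   <= 2 * (exp (Rabs (Re b) * ln 3 + Rabs (Im b) * PI) * Cmod (binc b (S N))))%R.
Proof.
  intros Hs. set (w := cubrt1 s).
  set (M := exp (Rabs (Re b) * ln 3 + Rabs (Im b) * PI)).
  set (E := fun t => Cexp (b * clog s t)).
  set (dE := fun t => E t * (b * clog_derive s t)).
  (* The 1 in the statement is the value of the product at t = 0, so the claim bounds an increment
     over [0, 1]. *)
  assert (H0 : E 0%R * binpoly b w N 0 = 1).
  { unfold E. rewrite clog_0, Cmult_0_r, Cexp_0, Cmult_1_l.
    unfold binpoly. clear. induction N as [|N IH].
    - rewrite sum_O. unfold binc. simpl. field.
    - rewrite sum_n_SC, IH, !Cpow_S. ring. }
  rewrite <- H0.
  apply (Cmod_increment_le_pow (fun t => E t * binpoly b w N t)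
           (fun t => dE t * binpoly b w N t + E t * binpoly_derive b w N t)
           (M * Cmod (binc b (S N))) N).
  - intros t Ht. apply is_Cderive_mult; [|apply is_Cderive_binpoly].
    apply is_Cderive_exp.
    assert (H := is_Cderive_mult _ _ t _ _ (is_Cderive_const b t)
                   (is_Cderive_clog s t Hs (proj1 Ht))).
    now rewrite Cmult_0_l, Cplus_0_l in H.
  - intros t Ht.
    set (D := dE t * binpoly b w N t + E t * binpoly_derive b w N t).
    (* Multiplying by 1 - w t turns the logarithmic derivative of [E] into -b w, so that
       [binpoly_ode] applies. *)
    assert (HD : (1 - w * t) * D
                 = - (E t * (INR (S N) * binc b (S N) * w ^ S N * RtoC t ^ N))).
    { transitivity (E t * ((1 - w * t) * binpoly_derive b w N t
        + ((1 - w * t) * clog_derive s t) * b * binpoly b w N t));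
        [unfold D, dE; ring|].
      assert (Hl := clog_derive_spec s t Hs (proj1 Ht)). fold w in Hl.
      rewrite Hl.
      transitivity (E t * ((1 - w * t) * binpoly_derive b w N t
                           - b * w * binpoly b w N t)); [ring|].
      rewrite binpoly_ode. ring. }
    apply (f_equal Cmod) in HD.
    rewrite Cmod_opp, !Cmod_mult, !Cmod_pow, !Cmod_R in HD.
    assert (Hw := Cmod_cubrt1 s Hs). fold w in Hw. rewrite Hw, pow1 in HD.
    rewrite !Rabs_pos_eq in HD by (apply pos_INR || apply Ht).
    assert (HE : (Cmod (E t) <= M)%R).
    { unfold E. rewrite Cmod_Cexp.
      destruct (Re_mult_clog_le b s t Ht) as [H|H];
        [left; now apply exp_increasing | rewrite H; apply Rle_refl]. }
    assert (H1 := Cmod_one_minus_cubrt1_ge s t (proj1 Ht)). fold w in H1.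
    assert (HDp := Cmod_ge_0 D).
    (* Since |1 - w t| >= 1, bounding the product in [HD] bounds [D] itself. *)
    apply Rle_trans with (Cmod (1 - w * t) * Cmod D)%R; [nra|].
    rewrite HD.
    replace (M * Cmod (binc b (S N)) * (INR (S N) * t ^ N))%R
      with (M * (INR (S N) * Cmod (binc b (S N)) * 1 * t ^ N))%R by ring.
    apply Rmult_le_compat_r; [|exact HE].
    assert (Hc := Cmod_ge_0 (binc b (S N))). assert (Hn := pos_INR (S N)).
    assert (Ht' := pow_le t N (proj1 Ht)).
    repeat apply Rmult_le_pos; lra.
Qed.

(** The limit e = (1 - w)^(-b) is the inverse of the exponential in [binpoly_error]; multiplying
    that estimate by e isolates the partial sum. *)
Lemma is_lim_seq_binpoly (b : C) (s : R) : (s * s = 3 / 4)%R -> (Re b < 0)%R ->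
  is_lim_seq
    (fun N => Cmod (binpoly b (cubrt1 s) N 1 - Cexp (- (b * clog s 1)))) 0.
Proof.
  intros Hs Hb. set (M := exp (Rabs (Re b) * ln 3 + Rabs (Im b) * PI)).
  set (e := Cexp (- (b * clog s 1))).
  assert (He : e * Cexp (b * clog s 1) = 1).
  { unfold e. rewrite <- Cexp_plus, <- Cexp_0. f_equal. ring. }
  apply (is_lim_seq_le_le (fun _ => 0%R) _
           (fun N => (Cmod e * 2 * M * Cmod (binc b (S N)))%R)).
  - intros N. split; [apply Cmod_ge_0|].
    replace (binpoly b (cubrt1 s) N 1 - e) with
      (e * (Cexp (b * clog s 1) * binpoly b (cubrt1 s) N 1 - 1)).
    + rewrite Cmod_mult, !Rmult_assoc.
      apply Rmult_le_compat_l; [apply Cmod_ge_0|].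
      now apply binpoly_error.
    + transitivity (e * Cexp (b * clog s 1) * binpoly b (cubrt1 s) N 1 - e);
        [ring|].
      rewrite He. ring.
  - apply is_lim_seq_const.
  - replace (Finite 0) with (Rbar_mult (Cmod e * 2 * M)%R 0)
      by (simpl; f_equal; ring).
    apply is_lim_seq_scal_l. now apply is_lim_seq_binc.
Qed.

(** * Trisection of a series by the cube roots of unity *)

Lemma cubrt1_cube (s : R) : (s * s = 3 / 4)%R -> cubrt1 s ^ 3 = 1.
Proof.
  intros Hs. unfold cubrt1. apply injective_projections; simpl.
  - transitivity (- / 8 + 3 / 2 * (s * s))%R; [field | rewrite Hs; field].
  - transitivity (3 / 4 * s - s * (s * s))%R; [field | rewrite Hs; field].
Qed.

Lemma cubrt1_pow (s : R) (j r : nat) : (s * s = 3 / 4)%R ->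
  cubrt1 s ^ (3 * j + r) = cubrt1 s ^ r.
Proof.
  intros Hs. rewrite Cpow_add_r, Cpow_mult_r, cubrt1_cube, Cpow_1_l by exact Hs.
  ring.
Qed.

(** For s^2 = 3/4, the sum of the n-th powers of all cube roots of unity: 3 if 3 divides n, and 0
    otherwise. *)
Definition cubrt1_trace (s : R) (n : nat) : C :=
  1 + cubrt1 s ^ n + cubrt1 (- s) ^ n.

Lemma cubrt1_trace_mod (s : R) (j r : nat) : (s * s = 3 / 4)%R ->
  cubrt1_trace s (3 * j + r) = cubrt1_trace s r.
Proof.
  intros Hs. unfold cubrt1_trace. rewrite !cubrt1_pow by nra. reflexivity.
Qed.

Lemma cubrt1_trace_values (s : R) : (s * s = 3 / 4)%R ->
  cubrt1_trace s 0 = 3 /\ cubrt1_trace s 1 = 0 /\ cubrt1_trace s 2 = 0.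
Proof.
  intros Hs. unfold cubrt1_trace, cubrt1.
  repeat split; apply injective_projections; simpl; nra.
Qed.

(** The trace at n - r selects n = r mod 3; the exponent 2r + n has the same residue and stays in
    [nat]. The upper limit 3J + 2 completes the last block of three. *)
Lemma sum_trisection (u : nat -> C) (s : R) (J r : nat) :
  (s * s = 3 / 4)%R -> (r < 3)%nat ->
  3 * sum_n (fun j => u (3 * j + r)%nat) J
  = sum_n (fun n => u n * cubrt1_trace s (2 * r + n)) (3 * J + 2).
Proof.
  intros Hs Hr. destruct (cubrt1_trace_values s Hs) as (T0 & T1 & T2).
  assert (T : forall j, u (3 * j)%nat * cubrt1_trace s (2 * r + 3 * j)
    + u (3 * j + 1)%nat * cubrt1_trace s (2 * r + (3 * j + 1))
    + u (3 * j + 2)%nat * cubrt1_trace s (2 * r + (3 * j + 2))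
    = 3 * u (3 * j + r)%nat).
  { intros j.
    destruct r as [|[|[|r]]]; [| | |lia];
    [ replace (2 * 0 + 3 * j)%nat with (3 * j + 0)%nat by lia;
      replace (2 * 0 + (3 * j + 1))%nat with (3 * j + 1)%nat by lia;
      replace (2 * 0 + (3 * j + 2))%nat with (3 * j + 2)%nat by lia
    | replace (2 * 1 + 3 * j)%nat with (3 * j + 2)%nat by lia;
      replace (2 * 1 + (3 * j + 1))%nat with (3 * (j + 1) + 0)%nat by lia;
      replace (2 * 1 + (3 * j + 2))%nat with (3 * (j + 1) + 1)%nat by lia
    | replace (2 * 2 + 3 * j)%nat with (3 * (j + 1) + 1)%nat by lia;
      replace (2 * 2 + (3 * j + 1))%nat with (3 * (j + 1) + 2)%nat by lia;
      replace (2 * 2 + (3 * j + 2))%nat with (3 * (j + 2) + 0)%nat by lia ];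
    rewrite !cubrt1_trace_mod, T0, T1, T2 by exact Hs;
    rewrite ?Nat.add_0_r; ring. }
  induction J as [|J IH].
  - rewrite sum_O. change (3 * 0 + 2)%nat with 2%nat.
    rewrite !sum_n_SC, sum_O. symmetry. exact (T 0%nat).
  - rewrite sum_n_SC, Cmult_plus_distr_l, IH, <- T.
    replace (3 * S J + 2)%nat with (S (S (S (3 * J + 2)))) by lia.
    rewrite !sum_n_SC.
    replace (3 * S J + 2)%nat with (S (S (S (3 * J + 2)))) by lia.
    replace (3 * S J + 1)%nat with (S (S (3 * J + 2))) by lia.
    replace (3 * S J)%nat with (S (3 * J + 2)) by lia.
    ring.
Qed.

Lemma sum_cubrt1_trace (b : C) (s : R) (m N : nat) :
  sum_n (fun n => binc b n * cubrt1_trace s (m + n)) N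
  = sum_n (binc b) N + cubrt1 s ^ m * binpoly b (cubrt1 s) N 1
    + cubrt1 (- s) ^ m * binpoly b (cubrt1 (- s)) N 1 :> C.
Proof.
  unfold binpoly, cubrt1_trace. induction N as [|N IH].
  - rewrite !sum_O. rewrite !Cpow_add_r. simpl. ring.
  - rewrite !sum_n_SC, IH, !Cpow_add_r, !Cpow_1_l. ring.
Qed.

Lemma is_series_of_Cmod (u : nat -> C) (l : C) :
  is_lim_seq (fun n => Cmod (sum_n u n - l)) 0 -> is_series u l.
Proof.
  intros H. apply filterlim_locally. intros eps.
  apply is_lim_seq_spec in H. destruct (H eps) as [N HN].
  exists N. intros n Hn. apply C_NormedModule_mixin_compat1.
  assert (Hlt := HN n Hn). rewrite Rminus_0_r in Hlt.
  eapply Rle_lt_trans; [apply Rle_abs|]. exact Hlt.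
Qed.

(** Trisection expresses three times the partial sum through the partial sums at 1 and at the two
    primitive roots. The first tends to 0, so only the primitive roots contribute to the limit. *)
Lemma is_series_binc_mod3_clog (b : C) (s : R) (r : nat) :
  (s * s = 3 / 4)%R -> (Re b < 0)%R -> (r < 3)%nat ->
  is_series (fun j => binc b (3 * j + r))
    ((cubrt1 s ^ (2 * r) * Cexp (- (b * clog s 1))
      + cubrt1 (- s) ^ (2 * r) * Cexp (- (b * clog (- s) 1))) / 3).
Proof.
  intros Hs Hb Hr. apply is_series_of_Cmod.
  assert (Hs' : (- s * - s = 3 / 4)%R) by lra.
  set (e1 := Cexp (- (b * clog s 1))). set (e2 := Cexp (- (b * clog (- s) 1))).
  set (F := fun N => (Cmod (binc (b + 1) N)
    + Cmod (binpoly b (cubrt1 s) N 1 - e1)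
    + Cmod (binpoly b (cubrt1 (- s)) N 1 - e2))%R).
  assert (HF : is_lim_seq F 0).
  { replace (Finite 0) with (Finite (0 + 0 + 0)%R) by (f_equal; ring).
    apply is_lim_seq_plus'; [apply is_lim_seq_plus'|].
    - now apply is_lim_seq_binc_plus_1.
    - now apply is_lim_seq_binpoly.
    - now apply is_lim_seq_binpoly. }
  apply (is_lim_seq_le_le (fun _ => 0%R) _ (fun J => F (3 * J + 2)%nat)).
  - intros J. split; [apply Cmod_ge_0|].
    set (N := (3 * J + 2)%nat).
    assert (H3 := sum_trisection (binc b) s J r Hs Hr).
    rewrite sum_cubrt1_trace, <- sum_binc in H3. fold N in H3.
    set (S := sum_n _ J) in *.
    set (z1 := cubrt1 s ^ (2 * r)) in *.
    set (z2 := cubrt1 (- s) ^ (2 * r)) in *.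
    assert (Hz1 : Cmod z1 = 1%R)
      by (unfold z1; now rewrite Cmod_pow, Cmod_cubrt1, pow1).
    assert (Hz2 : Cmod z2 = 1%R)
      by (unfold z2; now rewrite Cmod_pow, Cmod_cubrt1, pow1).
    assert (E : 3 * (S - (z1 * e1 + z2 * e2) / 3)
      = binc (b + 1) N + z1 * (binpoly b (cubrt1 s) N 1 - e1)
        + z2 * (binpoly b (cubrt1 (- s)) N 1 - e2)).
    { transitivity (3 * S - (z1 * e1 + z2 * e2)); [field|].
      rewrite H3. ring. }
    set (D := S - _) in *.
    assert (HD : (Cmod (3 * D) <= F N)%R).
    { rewrite E. unfold F.
      eapply Rle_trans; [apply Cmod_triangle|].
      rewrite Cmod_mult, Hz2, Rmult_1_l. apply Rplus_le_compat_r.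
      eapply Rle_trans; [apply Cmod_triangle|].
      rewrite Cmod_mult, Hz1, Rmult_1_l. apply Rle_refl. }
    (* |D| <= 3 |D| suffices, so the factor 3 is simply dropped. *)
    rewrite Cmod_mult, Cmod_R, Rabs_pos_eq in HD by lra.
    assert (HDp := Cmod_ge_0 D). lra.
  - apply is_lim_seq_const.
  - apply (is_lim_seq_subseq F 0 (fun J => (3 * J + 2)%nat)); [|exact HF].
    apply eventually_subseq. intros n. lia.
Qed.

(** * Closed form of the sums over a residue class mod 3 *)

Lemma cubrt1_Cexp (s : R) : (s = sqrt 3 / 2)%R ->
  cubrt1 s = Cexp (Ci * (2 * PI / 3)) /\
  cubrt1 (- s) = Cexp (- (Ci * (2 * PI / 3))).
Proof.
  intros ->.
  replace (Ci * (2 * PI / 3)) with ((0, 2 * (PI / 3))%R : C)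
    by (apply injective_projections; simpl; field).
  split; unfold Cexp, cubrt1; simpl;
    rewrite ?Ropp_0, exp_0, ?cos_neg, ?sin_neg, cos_2PI3, sin_2PI3;
    apply injective_projections; simpl; field.
Qed.

Lemma Cexp_pow (z : C) (n : nat) : Cexp z ^ n = Cexp (INR n * z).
Proof.
  induction n as [|n IH].
  - simpl. rewrite Cmult_0_l, Cexp_0. reflexivity.
  - rewrite Cpow_S, IH, <- Cexp_plus, Cnat_S. f_equal. ring.
Qed.

(** In polar form, 1 - w = sqrt 3 exp(-i PI / 6) for w = exp(2 i PI / 3), and the other root gives
    the conjugate. *)
Lemma clog_1 (s : R) : (s = sqrt 3 / 2)%R ->
  clog s 1 = ln 3 / 2 - Ci * (PI / 6) /\
  clog (- s) 1 = ln 3 / 2 + Ci * (PI / 6).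
Proof.
  intros ->. assert (H3 := Rlt_sqrt3_0).
  assert (Ha : atan (sqrt 3 / 2 * 1 / (1 + 1 / 2)) = (PI / 6)%R).
  { rewrite <- (atan_tan (PI / 6)); [|assert (H := PI_RGT_0); lra].
    f_equal. rewrite tan_PI6.
    field_simplify_eq; [|lra]. rewrite <- Rsqr_pow2, Rsqr_sqrt; lra. }
  unfold clog.
  replace (- (sqrt 3 / 2) * 1 / (1 + 1 / 2))%R
    with (- (sqrt 3 / 2 * 1 / (1 + 1 / 2)))%R by field.
  rewrite atan_opp, Ha. replace (1 + 1 + 1 * 1)%R with 3%R by ring.
  split; apply injective_projections; simpl; field.
Qed.

Lemma is_series_binc_mod3 (b : C) (r : nat) :
  (Re b < 0)%R -> (r < 3)%nat ->
  is_series (fun j => binc b (3 * j + r))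
    (2 / 3 * Rpower_C 3 (- (b / 2)) * Ccos (PI * b / 6 + 4 * PI * INR r / 3)).
Proof.
  intros Hb Hr. set (s := (sqrt 3 / 2)%R).
  assert (Hs : (s * s = 3 / 4)%R).
  { unfold s. assert (H := sqrt_sqrt 3 ltac:(lra)). lra. }
  assert (H := is_series_binc_mod3_clog b s r Hs Hb Hr).
  destruct (cubrt1_Cexp s eq_refl) as [W1 W2].
  destruct (clog_1 s eq_refl) as [L1 L2].
  rewrite W1, W2, L1, L2, !Cexp_pow, <- !Cexp_plus in H.
  replace (RtoC (INR (2 * r))) with (2 * INR r) in H
    by now rewrite mult_INR, RtoC_mult.
  (* The exponents of the two terms are p + q and p - q: exp p is 3^(-b/2), and the terms in q add
     up to twice a cosine. *)
  set (p := - (b / 2) * ln 3).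
  set (q := Ci * (PI * b / 6 + 4 * PI * INR r / 3)).
  replace (2 * INR r * (Ci * (2 * PI / 3)) + - (b * (ln 3 / 2 - Ci * (PI / 6))))
    with (p + q) in H by (unfold p, q; field).
  replace (2 * INR r * - (Ci * (2 * PI / 3)) + - (b * (ln 3 / 2 + Ci * (PI / 6))))
    with (p + - q) in H by (unfold p, q; field).
  replace (2 / 3 * Rpower_C 3 (- (b / 2)) * Ccos (PI * b / 6 + 4 * PI * INR r / 3))
    with ((Cexp (p + q) + Cexp (p + - q)) / 3); [exact H|].
  unfold Rpower_C, Ccos. fold p q. rewrite !Cexp_plus. field.
Qed.

(** * The hypergeometric series *)

Lemma Ccos_plus_PI (z : C) : Ccos (z + PI) = - Ccos z.
Proof.
  assert (E : forall x : R, (x = PI \/ x = - PI)%R -> Cexp (0%R, x) = - (1)).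
  { intros x Hx. unfold Cexp. simpl.
    destruct Hx as [-> | ->]; rewrite exp_0, ?cos_neg, ?sin_neg, cos_PI, sin_PI;
      apply injective_projections; simpl; ring. }
  unfold Ccos.
  replace (Ci * (z + PI)) with (Ci * z + (0%R, PI))
    by (apply injective_projections; simpl; ring).
  replace (- (Ci * z + (0%R, PI))) with (- (Ci * z) + (0%R, (- PI)%R))
    by (apply injective_projections; simpl; ring).
  rewrite !Cexp_plus, !E by auto. field.
Qed.

Lemma Rpower_C_plus_1 (x : R) (z : C) : (0 < x)%R ->
  Rpower_C x (z + 1) = x * Rpower_C x z.
Proof.
  intros Hx. unfold Rpower_C.
  rewrite Cmult_plus_distr_r, Cmult_1_l, Cexp_plus.
  replace (Cexp (ln x)) with (RtoC x); [ring|].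
  unfold Cexp. simpl. rewrite exp_ln, cos_0, sin_0 by exact Hx.
  apply injective_projections; simpl; ring.
Qed.

Lemma poch_neq_0 (x : R) (n : nat) : (0 < x)%R -> poch x n <> 0.
Proof.
  intros Hx. induction n as [|n IH]; simpl; [apply C1_nz|].
  apply Cmult_neq_0; [exact IH|]. rewrite <- RtoC_plus.
  intros H. apply RtoC_inj in H. assert (Hn := pos_INR n). lra.
Qed.

(** The powers 27^j cancel. For d = 1/3, 2/3, 1 the triple d, d + 1/3, d + 2/3 consists of the two
    lower parameters and 1, the latter supplying the j! of the series. *)
Lemma poch_ratio_triplication (a : C) (d : R) (j : nat) : (0 < d)%R ->
  (poch a j * poch (a + 1 / 3) j * poch (a + 2 / 3) j)
  / (poch d j * poch (d + 1 / 3) j * poch (d + 2 / 3) j)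
  = poch (3 * a) (3 * j) / poch (3 * d) (3 * j).
Proof.
  intros Hd. rewrite !poch_triplication.
  assert (H27 : (27 : C) <> 0) by (intros H; apply RtoC_inj in H; lra).
  assert (N0 := poch_neq_0 d j Hd).
  assert (N1 := poch_neq_0 (d + 1 / 3) j ltac:(lra)).
  assert (N2 := poch_neq_0 (d + 2 / 3) j ltac:(lra)).
  rewrite RtoC_plus, RtoC_div in N1, N2 by lra.
  assert (N27 := Cpow_nz _ j H27).
  field. repeat split; assumption.
Qed.

Lemma is_series_Cmult (c l l' : C) (u v : nat -> C) :
  (forall n, u n = c * v n) -> l = c * l' -> is_series v l' -> is_series u l.
Proof.
  intros Hu -> Hv. apply (is_series_ext (fun n => c * v n)).
  - intros n. now rewrite Hu.
  - exact (is_series_scal c v l' Hv).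
Qed.

Lemma RtoC_third (x : R) : RtoC (x / 3) = x / 3.
Proof. apply RtoC_div. lra. Qed.

Lemma hyp3F2_term_binc_0 (a : C) (j : nat) :
  hyp3F2_term a (a + 1 / 3) (a + 2 / 3) (1 / 3) (2 / 3) j
  = 1 * binc (3 * a) (3 * j + 0).
Proof.
  assert (H := poch_ratio_triplication a (1 / 3) j ltac:(lra)).
  rewrite RtoC_third in H.
  replace (1 / 3 + 1 / 3) with (2 / 3 : C) in H by field.
  replace (1 / 3 + 2 / 3) with (1 : C) in H by field.
  replace (3 * (1 / 3)) with (1 : C) in H by field.
  rewrite !poch_1 in H. unfold hyp3F2_term, binc.
  now rewrite Nat.add_0_r, Cmult_1_l.
Qed.

(** Here 3d = 2: (2)_{3j} = (3j + 1)!, and (3a)_{3j} is (3a - 1)_{3j+1} without its first factor 3a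
    - 1, whence the constant. *)
Lemma hyp3F2_term_binc_1 (a : C) (j : nat) : 1 - 3 * a <> 0 ->
  hyp3F2_term a (a + 1 / 3) (a + 2 / 3) (2 / 3) (4 / 3) j
  = - / (1 - 3 * a) * binc (3 * a - 1) (3 * j + 1).
Proof.
  intros Ha.
  assert (H := poch_ratio_triplication a (2 / 3) j ltac:(lra)).
  rewrite RtoC_third in H.
  replace (2 / 3 + 1 / 3) with (1 : C) in H by field.
  replace (2 / 3 + 2 / 3) with (4 / 3 : C) in H by field.
  replace (3 * (2 / 3)) with (1 + 1 : C) in H by field.
  unfold hyp3F2_term, binc. rewrite <- !poch_1.
  rewrite Nat.add_1_r, !poch_S_l.
  replace (3 * a - 1 + 1) with (3 * a) by ring.
  transitivity (poch (3 * a) (3 * j) / poch (1 + 1) (3 * j)).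
  - rewrite <- H. f_equal. ring.
  - field. split; [|exact Ha].
    rewrite <- RtoC_plus. apply poch_neq_0. lra.
Qed.

(** Here 3d = 3: (3)_{3j} = (3j + 2)! / 2, and (3a)_{3j} is (3a - 2)_{3j+2} without its first two
    factors, whose signs cancel. *)
Lemma hyp3F2_term_binc_2 (a : C) (j : nat) : 1 - 3 * a <> 0 -> 2 - 3 * a <> 0 ->
  hyp3F2_term a (a + 1 / 3) (a + 2 / 3) (4 / 3) (5 / 3) j
  = 2 / ((1 - 3 * a) * (2 - 3 * a)) * binc (3 * a - 2) (3 * j + 2).
Proof.
  intros Ha1 Ha2.
  assert (H := poch_ratio_triplication a 1 j ltac:(lra)).
  replace (1 + 1 / 3) with (4 / 3 : C) in H by field.
  replace (1 + 2 / 3) with (5 / 3 : C) in H by field.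
  replace (3 * 1) with (1 + 1 + 1 : C) in H by ring.
  unfold hyp3F2_term, binc. rewrite <- !poch_1.
  replace (3 * j + 2)%nat with (S (S (3 * j))) by lia. rewrite !poch_S_l.
  replace (3 * a - 2 + 1 + 1) with (3 * a) by ring.
  transitivity (poch (3 * a) (3 * j) / poch (1 + 1 + 1) (3 * j)).
  - rewrite <- H. f_equal. ring.
  - field. repeat split; try assumption.
    rewrite <- !RtoC_plus. apply poch_neq_0. lra.
Qed.

Theorem proposition1 (a : C) :
  ((Re a < 0)%R ->
     is_hyp3F2_at_1 a (a + 1 / 3) (a + 2 / 3) (1 / 3) (2 / 3)
       (2 * Rpower_C 3 (- (3 * a / 2) - 1) * Ccos (PI * a / 2)))
  /\
  ((Re a < 1 / 3)%R ->
     is_hyp3F2_at_1 a (a + 1 / 3) (a + 2 / 3) (2 / 3) (4 / 3)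
       (2 / (1 - 3 * a) * Rpower_C 3 (- ((3 * a + 1) / 2))
          * Ccos ((3 * a + 1) * PI / 6)))
  /\
  ((Re a < 2 / 3)%R -> a <> 1 / 3 ->
     is_hyp3F2_at_1 a (a + 1 / 3) (a + 2 / 3) (4 / 3) (5 / 3)
       (4 / ((1 - 3 * a) * (2 - 3 * a)) * Rpower_C 3 (- (3 * a / 2))
          * Ccos ((3 * a + 2) * PI / 6))).
Proof.
  assert (Re3 : forall x : R, Re (3 * a - x) = (3 * Re a - x)%R)
    by (intros x; destruct a; simpl; ring).
  assert (Nz : forall x : R, (Re (3 * a - x) < 0)%R -> x - 3 * a <> 0).
  { intros x Hx H. replace (3 * a - x) with (- (x - 3 * a)) in Hx by ring.
    rewrite H in Hx. simpl in Hx. lra. }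
  unfold is_hyp3F2_at_1. split; [|split].
  - intros Ha.
    refine (is_series_Cmult 1 _ _ _ _ (hyp3F2_term_binc_0 a) _
              (is_series_binc_mod3 (3 * a) 0 _ _)); [| |lia].
    (* The extra power of 3 absorbs the 1/3 of the trisection; the other two cases do the same. *)
    + replace (- (3 * a / 2)) with (- (3 * a / 2) - 1 + 1) at 2 by ring.
      rewrite Rpower_C_plus_1 by lra.
      replace (PI * (3 * a) / 6 + 4 * PI * INR 0 / 3) with (PI * a / 2)
        by (simpl; field).
      field.
    + rewrite re_scal_l. lra.
  - intros Ha.
    assert (Hb : (Re (3 * a - 1) < 0)%R) by (rewrite Re3; lra).
    assert (N1 := Nz _ Hb).
    refine (is_series_Cmult (- / (1 - 3 * a)) _ _ _ _
              (fun j => hyp3F2_term_binc_1 a j N1) _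
              (is_series_binc_mod3 (3 * a - 1) 1 Hb _)); [|lia].
    replace (- ((3 * a - 1) / 2)) with (- ((3 * a + 1) / 2) + 1) by field.
    rewrite Rpower_C_plus_1 by lra.
    (* The phase exceeds the stated one by 4 PI / 3 - PI / 3 = PI; the resulting sign cancels that
       of -1 / (1 - 3a). *)
    replace (PI * (3 * a - 1) / 6 + 4 * PI * INR 1 / 3)
      with ((3 * a + 1) * PI / 6 + PI) by (simpl; field).
    rewrite Ccos_plus_PI. field. exact N1.
  - intros Ha Ha'.
    assert (Hb : (Re (3 * a - 2) < 0)%R) by (rewrite Re3; lra).
    assert (N2 := Nz _ Hb).
    assert (N1 : 1 - 3 * a <> 0).
    { intros H. apply Ha'. replace a with ((1 - (1 - 3 * a)) / 3) by field.
      rewrite H. field. }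
    refine (is_series_Cmult (2 / ((1 - 3 * a) * (2 - 3 * a))) _ _ _ _
              (fun j => hyp3F2_term_binc_2 a j N1 N2) _
              (is_series_binc_mod3 (3 * a - 2) 2 Hb _)); [|lia].
    replace (- ((3 * a - 2) / 2)) with (- (3 * a / 2) + 1) by field.
    rewrite Rpower_C_plus_1 by lra.
    (* Now the excess is 8 PI / 3 - 2 PI / 3 = 2 PI, a full period. *)
    replace (PI * (3 * a - 2) / 6 + 4 * PI * INR 2 / 3)
      with ((3 * a + 2) * PI / 6 + PI + PI) by (simpl; rewrite RtoC_plus; field).
    rewrite !Ccos_plus_PI. field. split; assumption.
Qed.
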